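(* Let $d>1$ be an integer and $q$ a prime power with $\gcd(q,d)=1$. Let $u_1,u_2\in\mathbb{F}_q^\ast$ and let $m$ be a positive integer. Then the polynomial $$f(x)=u_1(x^q-x)+u_2\left(x+x^q+\cdots+x^{q^{d-1}}\right)^m$$ is a permutation polynomial of $\mathbb{F}_{q^d}$ if and only if $\gcd(m,q-1)=1$. Moreover, if $f$ is a permutation polynomial of $\mathbb{F}_{q^d}$, then its compositional inverse on $\mathbb{F}_{q^d}$ is $$f^{-1}(x)=\frac1d(u_2d)^{-r}\left(x+x^q+\cdots+x^{q^{d-1}}\right)^r+\frac{d-1}{2du_1}\left(x+x^q+\cdots+x^{q^{d-1}}\right)-\frac{1}{du_1}\sum_{i=1}^{d-1}i\,x^{q^{d-1-i}},$$ where $r$ is a positive integer with $mr\equiv 1\pmod{q-1}$.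
   Context: A polynomial $f\in\mathbb{F}_Q[x]$ is a permutation polynomial of $\mathbb{F}_Q$ if $a\mapsto f(a)$ is a bijection of $\mathbb{F}_Q$; its compositional inverse is the (polynomial representing the) inverse map. *)

(* Defs.v *)
From mathcomp Require Import all_boot all_order all_algebra.

Set Implicit Arguments.
Unset Strict Implicit.
Unset Printing Implicit Defensive.

Import GRing.Theory.
Local Open Scope ring_scope.

Definition permutation_poly (K : finFieldType) (f : {poly K}) : Prop :=
  bijective (fun a : K => f.[a]).

(* A polynomial representing the inverse map is only determined modulo
   'X^#|K| - 'X, hence a relation between polynomials. *)
Definition compositional_inverse (K : finFieldType) (f g : {poly K}) : Prop :=
  cancel (fun a : K => f.[a]) (fun a : K => g.[a]) /\
  cancel (fun a : K => g.[a]) (fun a : K => f.[a]).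

Definition trace_poly (K : finFieldType) (q d : nat) : {poly K} :=
  \sum_(0 <= i < d) 'X^(q ^ i).

Definition f_poly (K : finFieldType) (q d m : nat) (u1 u2 : K) : {poly K} :=
  u1 *: ('X^q - 'X) + u2 *: trace_poly K q d ^+ m.

(* The rational number (d - 1) / (2 d) is reduced in rat and only then mapped
   to K by ratr: in characteristic 2 one cannot divide by 2 in K, but d is then
   odd and (d - 1) / 2 is an integer. In every characteristic prime to d, the
   reduced denominator is nonzero in K. *)
Definition f_inv_poly (K : finFieldType) (q d r : nat) (u1 u2 : K) : {poly K} :=
  (d%:R^-1 * (u2 * d%:R) ^- r) *: trace_poly K q d ^+ r
  + (ratr ((d%:R - 1) / (2 * d%:R)) / u1) *: trace_poly K q d
  - (d%:R * u1)^-1 *: \sum_(1 <= i < d) i%:R *: 'X^(q ^ (d - 1 - i)).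

(* Main.v *)
Require Import Defs.
From mathcomp Require Import all_boot all_order all_algebra.
From mathcomp Require Import finfield ring.

Set Implicit Arguments.
Unset Strict Implicit.
Unset Printing Implicit Defensive.

Import GRing.Theory.
Local Open Scope ring_scope.

(* Let T be the trace and y = f(x). Since T(x) is fixed by the q-th power map,
   T(y) = d u2 T(x)^m, so T(x) = (T(y) / (u2 d))^r. Moreover y - T(y) / d =
   u1 (x^q - x), and the sum of the i (x^q - x)^(q^(d-1-i)) telescopes to
   T(x) - d x, whence x. Conversely f(b) = u2 (d b)^m for b in the subfield of
   order q, so if f is injective then so is the m-th power map there. *)

(* The denominator of a divides n, so it is also nonzero in K. *)
Lemma ratr_mulrn (K : fieldType) (a : rat) (n : nat) (z : int) :
  n%:R != 0 :> K -> a * n%:R = z%:~R -> ratr a * n%:R = z%:~R :> K.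
Proof.
move=> nK az.
have eqZ : numq a * n%:Z = z * denq a.
  apply/eqP; rewrite -(eqr_int rat) !rmorphM /= numqE -az -pmulrn.
  by rewrite mulrAC.
have /dvdzP[k nk] : (denq a %| n%:Z)%Z.
  rewrite -(@Gauss_dvdzr _ (numq a)) ?eqZ ?dvdz_mull //.
  by rewrite coprimez_sym; exact: coprime_num_den.
have nE : n%:R = k%:~R * (denq a)%:~R :> K by rewrite -intrM -nk -pmulrn.
have zE : z = numq a * k.
  by apply: (mulIf (denq_neq0 a)); rewrite -eqZ nk mulrA.
have dK : (denq a)%:~R != 0 :> K.
  by apply: contraNneq nK => d0; rewrite nE d0 mulr0.
by rewrite nE zE intrM /ratr; field.
Qed.

(** Multiplying by [d ^ 2] clears the denominator without dividing by 2 in [K], so characteristic 2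
    is covered. The value ['C(d, 2)] is the sum of the weights [i < d] that appears in
    [weighted_sum_f]. *)
Lemma ratr_half_pred_div (K : fieldType) (d : nat) :
  d%:R != 0 :> K ->
  ratr ((d%:R - 1) / (2 * d%:R)) * (d ^ 2)%:R = 'C(d, 2)%:R :> K.
Proof.
case: d => [|d] dK; first by rewrite eqxx in dK.
apply: (@ratr_mulrn _ _ _ 'C(d.+1, 2)%:Z); first by rewrite natrX expf_neq0.
have : ('C(d.+1, 2) * 2)%:R = (d.+1 * d)%:R :> rat.
  by rewrite bin2 muln2 halfK /= oddM /= andNb subn0.
rewrite !natrM => H.
have d0 : d.+1%:R != 0 :> rat by rewrite Num.Theory.pnatr_eq0.
have CE : 'C(d.+1, 2)%:R = d.+1%:R * d%:R / 2 :> rat by rewrite -H; field.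
rewrite -pmulrn CE; rewrite -natr1 in d0 *.
by field.
Qed.

Lemma card_pchar_nat (F : finFieldType) : [pchar F].-nat #|F|.
Proof.
have [p p_pr pF] := finPcharP F.
by rewrite (card_pprimeChar pF) pnatX pnatE // pF.
Qed.

(** The characteristic divides [#|F|], a power of it greater than 1, so it cannot also divide
    [d]. *)
Lemma coprime_card_natf_neq0 (F : finFieldType) (d : nat) :
  coprime #|F| d -> d%:R != 0 :> F.
Proof.
have [p p_pr pF] := finPcharP F.
rewrite -(dvdn_pcharf pF) => co; apply/negP => pd.
have: (0 < logn p #|F|)%N.
  rewrite lt0n; apply: contraTneq (finNzRing_gt1 F) => l0.
  by rewrite (card_pprimeChar pF) l0.
rewrite logn_gt0 mem_primes => /and3P[_ _ pq].
have: (p %| gcdn #|F| d)%N by rewrite dvdn_gcd pq.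
by rewrite (eqP co) dvdn1 => /eqP p1; rewrite p1 in p_pr.
Qed.

Lemma expr_eq_modn_pred (K : idomainType) (q n : nat) (t : K) :
  (1 < q)%N -> (0 < n)%N -> t ^+ q = t -> n = 1 %[mod q - 1] -> t ^+ n = t.
Proof.
rewrite subn1 => q_gt1 n_gt0 tq n1.
have [->|t0] := eqVneq t 0; first by rewrite expr0n gtn_eqF.
have tq1 : t ^+ q.-1 = 1.
  by apply: (mulfI t0); rewrite mulr1 -exprS prednK // ltnW.
have /dvdnP[k nk] : (q.-1 %| n - 1)%N by rewrite -eqn_mod_dvd //; apply/eqP.
by rewrite -(subnK n_gt0) addn1 exprS nk mulnC exprM tq1 expr1n mulr1.
Qed.

(** Let [g] be the gcd and [k = (#|F| - 1) / g]. For [b != 0], [(b ^+ k) ^+ m] is a power of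
    [b ^+ #|F|.-1 = 1], so injectivity gives [b ^+ k = 1]. All [#|F| - 1] nonzero elements are then
    [k]-th roots of unity, which forces [#|F| - 1 <= k] and [g = 1]. *)
Lemma inj_expr_coprime (F : finFieldType) (m : nat) :
  injective (fun b : F => b ^+ m) -> coprime m (#|F| - 1).
Proof.
move=> inj; have q_gt1 := finNzRing_gt1 F; rewrite subn1.
have q1_gt0 : (0 < #|F|.-1)%N by rewrite -ltnS prednK // ltnW.
have g_gt0 : (0 < gcdn m #|F|.-1)%N by rewrite gcdn_gt0 q1_gt0 orbT.
have /dvdnP[k qk] := dvdn_gcdr m #|F|.-1.
have /dvdnP[l ml] := dvdn_gcdl m #|F|.-1.
move: g_gt0 qk ml; rewrite /coprime; set g := gcdn _ _ => g_gt0 qk ml.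
have k_gt0 : (0 < k)%N by move: q1_gt0; rewrite qk muln_gt0 => /andP[].
suff: (#|F|.-1 <= k)%N.
  by rewrite qk -{2}[k]muln1 leq_pmul2l // => g1; rewrite eqn_leq g1.
rewrite -(cardC1 (0 : F)) cardE; apply: max_unity_roots (enum_uniq _) => //.
apply/allP => b; rewrite mem_enum inE unity_rootE => b0.
apply/eqP/inj; rewrite expr1n -exprM ml mulnCA -qk mulnC exprM.
have -> : b ^+ #|F|.-1 = 1; last by rewrite expr1n.
by apply: (mulfI b0); rewrite mulr1 -exprS prednK ?expf_card // ltnW.
Qed.

Section Trace.

Variables (K : finFieldType) (q d : nat).
Hypothesis q_pchar : [pchar K].-nat q.
Hypothesis expr_qd : forall x : K, x ^+ (q ^ d) = x.

Local Notation T x := (trace_poly K q d).[x].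

Lemma horner_trace (x : K) : T x = \sum_(0 <= i < d) x ^+ (q ^ i).
Proof. by rewrite horner_sum; apply: eq_bigr => i _; rewrite hornerXn. Qed.

Lemma exprD_qX (x y : K) i : (x + y) ^+ (q ^ i) = x ^+ (q ^ i) + y ^+ (q ^ i).
Proof. by rewrite exprDn_pchar // pnatX q_pchar. Qed.

Lemma exprB_qX (x y : K) i : (x - y) ^+ (q ^ i) = x ^+ (q ^ i) - y ^+ (q ^ i).
Proof. by apply/eqP; rewrite eq_sym subr_eq -exprD_qX subrK. Qed.

Lemma expr_qX_fixed (t : K) i : t ^+ q = t -> t ^+ (q ^ i) = t.
Proof. by move=> tq; elim: i => // i IH; rewrite expnSr exprM IH. Qed.

Lemma horner_trace_fixed (t : K) : t ^+ q = t -> T t = d%:R * t.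
Proof.
move=> tq; rewrite horner_trace (eq_bigr (fun=> t)) => [|i _].
  by rewrite sumr_const_nat subn0 mulr_natl.
exact: expr_qX_fixed.
Qed.

Lemma trace_expr_q (x : K) : T x ^+ q = T x.
Proof.
have q0 : (0 : K) ^+ q = 0 by rewrite expr0n gtn_eqF //; case/andP: q_pchar.
have qD (y z : K) : (y + z) ^+ q = y ^+ q + z ^+ q by rewrite exprDn_pchar.
rewrite horner_trace (big_morph _ qD q0).
(* With this term added, both sides are the sum of [x ^+ (q ^ i)] over [i <= d], split off at the
   first or at the last index; the last term is [x] again. *)
apply: (addrI (x ^+ (q ^ 0))).
have -> : \sum_(0 <= i < d) (x ^+ (q ^ i)) ^+ q
          = \sum_(0 <= i < d) x ^+ (q ^ i.+1).
  by apply: eq_bigr => i _; rewrite -exprM expnSr.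
rewrite -(@big_nat_recl _ _ _ d 0 (fun i => x ^+ (q ^ i))) // big_nat_recr //=.
by rewrite expr_qd expn0 expr1 addrC.
Qed.

Variables (m : nat) (u1 u2 : K).
Hypotheses (u1_q : u1 ^+ q = u1) (u2_q : u2 ^+ q = u2).

Local Notation f := (f_poly q d m u1 u2).

Lemma horner_f (x : K) : f.[x] = u1 * (x ^+ q - x) + u2 * T x ^+ m.
Proof. by rewrite /f_poly !hornerE. Qed.

(** The [q]-th power map is additive and fixes [u1], [u2] and [T x], so only the difference is
    moved. *)
Lemma horner_f_qX (x : K) i :
  f.[x] ^+ (q ^ i)
  = u1 * (x ^+ (q ^ i.+1) - x ^+ (q ^ i)) + u2 * T x ^+ m.
Proof.
rewrite horner_f exprD_qX exprMn exprB_qX -exprM -expnS.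
congr (_ * _ + _); apply: expr_qX_fixed => //.
by rewrite exprMn u2_q exprAC trace_expr_q.
Qed.

Lemma trace_f (x : K) : T f.[x] = d%:R * (u2 * T x ^+ m).
Proof.
rewrite horner_trace; under eq_bigr do rewrite horner_f_qX.
rewrite big_split /= -mulr_sumr telescope_sumr // expr_qd expn0 expr1 subrr.
by rewrite mulr0 add0r sumr_const_nat subn0 mulr_natl.
Qed.

Lemma weighted_sum_telescope (x : K) :
  \sum_(0 <= i < d)
     i%:R * (x ^+ (q ^ (d - 1 - i).+1) - x ^+ (q ^ (d - 1 - i)))
  = T x - d%:R * x.
Proof.
(* Summation by parts: each summand is [x ^+ (q ^ (d - i.+1))] minus an increment of [g]. The first
   terms add up to the trace in reverse order, and [g d - g 0 = d%:R * x]. *)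
pose g i := i%:R * x ^+ (q ^ (d - i)).
transitivity (\sum_(0 <= i < d) (x ^+ (q ^ (d - i.+1)) - (g i.+1 - g i))).
  apply: eq_big_nat => i /andP[_ id]; rewrite /g -subnDA add1n subnSK //.
  by rewrite -natr1; ring.
rewrite sumrB telescope_sumr // /g subnn expn0 expr1 mul0r subr0; congr (_ - _).
rewrite horner_trace big_nat_rev /=; apply: eq_big_nat => i /andP[_ id].
by rewrite add0n subnSK // subKn // ltnW.
Qed.

Lemma weighted_sum_f (x : K) :
  \sum_(1 <= i < d) i%:R * f.[x] ^+ (q ^ (d - 1 - i))
  = u1 * (T x - d%:R * x) + 'C(d, 2)%:R * (u2 * T x ^+ m).
Proof.
have from0 n (G : nat -> K) : G 0%N = 0 ->
    \sum_(1 <= i < n) G i = \sum_(0 <= i < n) G i.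
  move=> G0; case: n => [|n]; first by rewrite !big_geq.
  by rewrite [RHS]big_ltn // G0 add0r.
rewrite from0 ?mul0r //.
rewrite -weighted_sum_telescope mulr_sumr -bin2_sum natr_sum mulr_suml.
by rewrite -big_split /=; apply: eq_bigr => i _; rewrite horner_f_qX; ring.
Qed.

Lemma f_inv_polyK (r : nat) :
  (1 < q)%N -> d%:R != 0 :> K -> u1 != 0 -> u2 != 0 ->
  (0 < m * r)%N -> m * r = 1 %[mod q - 1] ->
  cancel (fun a : K => f.[a]) (fun a : K => (f_inv_poly q d r u1 u2).[a]).
Proof.
move=> q_gt1 d0 u10 u20 mr_gt0 mr1 x.
have Tmr : (T x ^+ m) ^+ r = T x.
  rewrite -exprM; apply: (expr_eq_modn_pred q_gt1) => //.
  exact: trace_expr_q.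
have := ratr_half_pred_div d0; rewrite /f_inv_poly; set c := ratr _ => cE.
have hornerS (y : K) :
    (\sum_(1 <= i < d) i%:R *: 'X^(q ^ (d - 1 - i)) : {poly K}).[y]
    = \sum_(1 <= i < d) i%:R * y ^+ (q ^ (d - 1 - i)).
  by rewrite horner_sum; apply: eq_bigr => i _; rewrite !hornerE.
move: (trace_f x) (weighted_sum_f x); rewrite -hornerS; move: f.[x] => y Ty Sy.
have Tyr : T y ^+ r = (u2 * d%:R) ^+ r * T x.
  by rewrite Ty mulrA exprMn Tmr [d%:R * u2]mulrC.
(* Once ['C(d, 2)] is written as [c * d ^ 2], the [u2 * T x ^+ m] terms cancel for any [c], and only
   [d], [u1] and the power of [u2 * d] need to be nonzero. *)
rewrite !hornerE Tyr Ty Sy -cE natrX.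
have : (u2 * d%:R) ^+ r != 0 by rewrite expf_neq0 // mulf_neq0.
move: ((u2 * d%:R) ^+ r) => e e0; field.
by rewrite ?e0 ?u10 ?d0.
Qed.

End Trace.

Theorem theorem6p2 (q d m : nat) (F K : finFieldType)
    (iota : {rmorphism F -> K}) (u1 u2 : F)
    (card_F : #|F| = q) (card_K : #|K| = (q ^ d)%N)
    (d_gt1 : (1 < d)%N) (co_qd : coprime q d)
    (u1_neq0 : u1 != 0) (u2_neq0 : u2 != 0) (m_gt0 : (0 < m)%N) :
  let f := f_poly q d m (iota u1) (iota u2) in
  (permutation_poly f <-> coprime m (q - 1)) /\
  (permutation_poly f ->
   forall r : nat, (0 < r)%N -> m * r = 1 %[mod q - 1] ->
   compositional_inverse f (f_inv_poly q d r (iota u1) (iota u2))).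
Proof.
move=> f.
have q_gt1 : (1 < q)%N by rewrite -card_F finNzRing_gt1.
have q_pchar : [pchar K].-nat q.
  by rewrite (eq_pnat _ (fmorph_pchar iota)) -card_F card_pchar_nat.
have expr_qd (x : K) : x ^+ (q ^ d) = x by rewrite -card_K expf_card.
have iota_q b : iota b ^+ q = iota b by rewrite -rmorphXn -card_F expf_card.
have dF : d%:R != 0 :> F by rewrite coprime_card_natf_neq0 ?card_F.
have dK : d%:R != 0 :> K by rewrite -(rmorph_nat iota) fmorph_eq0.
have invK r : (0 < r)%N -> m * r = 1 %[mod q - 1] ->
    cancel (fun a : K => f.[a])
           (fun a : K => (f_inv_poly q d r (iota u1) (iota u2)).[a]).
  by move=> r0; apply: f_inv_polyK; rewrite ?fmorph_eq0 ?muln_gt0 ?m_gt0.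
split; last first.
  move=> fbij r r0 mr1; split; first exact: invK.
  (* A left inverse of a bijection is also a right inverse. *)
  by apply/(bij_can_sym fbij)/invK.
split=> [/bij_inj finj | co].
  rewrite -card_F; apply: inj_expr_coprime => a b abm.
  apply: (fmorph_inj iota); apply: finj.
  rewrite /= !horner_f !iota_q !subrr !horner_trace_fixed //.
  by rewrite !exprMn -!rmorphXn abm.
(* Bezout gives [r * m = kn * (q - 1) + 1]. The left inverse built from this [r] makes [f]
   injective, hence bijective on the finite field [K]. *)
have [r kn E _] := egcdnP (q - 1) m_gt0; rewrite (eqP co) in E.
have r_gt0 : (0 < r)%N by case: r E => //; rewrite addn1.
apply/injF_bij/can_inj/(invK r) => //.
by rewrite mulnC E modnMDl.
Qed.
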